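(* Let $a,b\in\mathbb{N}$ and $c\in\mathbb{N}_0$. For $(p_\eta)\in\mathbb{N}^a$, $(q_\xi)\in\mathbb{N}^b$, $(r_\sigma)\in\mathbb{N}^c$, $$Z\bigl(z_{r_c}z_{r_{c-1}}\cdots z_{r_1}(z_{p_a}z_{p_{a-1}}\cdots z_{p_1}\mathbin{\mathrm{sh}}z_{q_b}z_{q_{b-1}}\cdots z_{q_1})\bigr)=\zeta_{a+b+c}(\{d_{ij}\};A_{a+b+c})$$ holds under the assumption that the right-hand side is convergent, where $$d_{ij}=\begin{cases} r_{c+1-j} & (i=1;\ 1\le j\le c),\\ p_{a+b+c+1-j} & (i=1;\ b+c+1\le j\le a+b+c),\\ q_{a+b+c+1-j} & (i=a+1;\ a+c+1\le j\le a+b+c),\\ 0 & (\text{otherwise}).\end{cases}$$ Furthermore, each step of the shuffle product procedure (SPP), given by $$\begin{aligned} & z_{r_c}z_{r_{c-1}}\cdots z_{r_1}(z_{p_a}\cdots z_{p_1}\mathbin{\mathrm{sh}}z_{q_b}\cdots z_{q_1})\\ &=\sum_{\tau=0}^{q_b-1}\binom{p_a-1+\tau}{\tau}z_{r_c}z_{r_{c-1}}\cdots z_{r_1}z_{p_a+\tau}(z_{p_{a-1}}\cdots z_{p_1}\mathbin{\mathrm{sh}}z_{q_b-\tau}z_{q_{b-1}}\cdots z_{q_1})\\ &\quad+\sum_{\tau=0}^{p_a-1}\binom{q_b-1+\tau}{\tau}z_{r_c}z_{r_{c-1}}\cdots z_{r_1}z_{q_b+\tau}(z_{p_a-\tau}z_{p_{a-1}}\cdots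 z_{p_1}\mathbin{\mathrm{sh}}z_{q_{b-1}}\cdots z_{q_1}),\end{aligned}$$ can be realized as the corresponding step of partial fraction decompositions (PFD) of zeta values of root systems.
   Context: $\mathbb{N}=\{1,2,\ldots\}$, $\mathbb{N}_0=\mathbb{N}\cup\{0\}$. $\mathfrak{H}=\mathbb{Q}\langle x,y\rangle$ is the non-commutative polynomial algebra over $\mathbb{Q}$ in $x,y$; $z_p=x^{p-1}y$ for $p\in\mathbb{N}$; $\mathfrak{H}^0=\mathbb{Q}+x\mathfrak{H}y$. The shuffle product $\mathrm{sh}$ is the $\mathbb{Q}$-bilinear product on $\mathfrak{H}$ with $1\mathbin{\mathrm{sh}}w=w\mathbin{\mathrm{sh}}1=w$ and $u_1w_1\mathbin{\mathrm{sh}}u_2w_2=u_1(w_1\mathbin{\mathrm{sh}}u_2w_2)+u_2(u_1w_1\mathbin{\mathrm{sh}}w_2)$ for words $w,w_1,w_2$ and letters $u_1,u_2\in\{x,y\}$; concatenation binds tighter than $\mathrm{sh}$. Empty products are $1$ and empty sums are $0$. The shuffle product procedure (SPP) is the procedure of writing $w_1\mathbin{\mathrm{sh}}w_2$ ($w_1,w_2\in\mathfrak{H}^0$) as a linear combination of words in $\mathfrak{H}^0$; it is performed by repeatedly applying the step displayed in the claim. Multiple zeta values: $\zeta(k_1,\ldots,k_N)=\sum_{m_1>\cdots>m_N>0}m_1^{-k_1}\cdots m_N^{-k_N}$ for $k_i\in\mathbb{N}$, $k_1>1$. $Z:\mathfrak{H}^0\to\mathbb{R}$ is the $\mathbb{Q}$-linear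 map with $Z(1)=1$ and $Z(z_{k_1}z_{k_2}\cdots z_{k_N})=\zeta(k_1,\ldots,k_N)$ for $k_1>1$. Zeta-function of the root system of type $A_N$: for $\mathbf{s}=(s_{ij})_{1\le i\le j\le N}$, $$\zeta_N(\mathbf{s};A_N)=\sum_{l_1,\ldots,l_N=1}^\infty\ \prod_{i=1}^{N}\prod_{j=i}^{N}\Bigl(\sum_{k=i}^{N+i-j}l_k\Bigr)^{-s_{ij}}.$$ Its values are the zeta values of root systems referred to in the claim. The convergence assumption amounts to: $p_a\ge2$ and $q_b\ge2$ if $c=0$; $r_c\ge2$ if $c\ge1$. The partial fraction decomposition in question is the identity of rational functions, for $\alpha,\beta\in\mathbb{N}$, $$\frac{1}{X^\alpha Y^\beta}=\sum_{\tau=0}^{\beta-1}\binom{\alpha-1+\tau}{\tau}\frac{1}{(X+Y)^{\alpha+\tau}Y^{\beta-\tau}}+\sum_{\tau=0}^{\alpha-1}\binom{\beta-1+\tau}{\tau}\frac{1}{(X+Y)^{\beta+\tau}X^{\alpha-\tau}},$$ used inside the series defining zeta values of root systems. The theorem can be illustrated by a commutative diagram of procedures: $Z$ maps $\mathfrak{H}^0$ to zeta values of root systems, and each SPP step on $\mathfrak{H}^0$ corresponds under $Z$ to a PFD step, i.e. a certain partial fraction decomposition, on zeta values of root systems. *)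

(* Defs.v *)
From HB Require Import structures.
From mathcomp Require Import all_boot all_order all_algebra all_fingroup.
From mathcomp Require Import all_classical all_reals esum.
From mathcomp Require Import -(notations) finmap monalg.

Set Implicit Arguments.
Unset Strict Implicit.
Unset Printing Implicit Defensive.

Import Order.TTheory GRing.Theory Num.Theory.

Local Open Scope classical_set_scope.
Local Open Scope ring_scope.

(* Q<x,y> is the monoid algebra over rat of the free monoid on two letters;
   the letter x is [false] and the letter y is [true]. *)
Notation Hxy := (malg (fmonom bool) rat).

Definition mkword (s : seq bool) : (fmonom bool) := FMonom s.
Definition gword (s : seq bool) : Hxy := mkmalgU (mkword s) 1.
Definition gx : Hxy := gword [:: false].
Definition gy : Hxy := gword [:: true].

Lemma gword1 : gword [::] = 1.
Proof. by congr (mkmalgU _ _); apply: val_inj; rewrite /= fm1. Qed.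

Lemma gwordM (s t : seq bool) : gword (s ++ t) = gword s * gword t.
Proof.
rewrite [RHS]malgM_def fgmulUU mulr1; congr (mkmalgU _ _).
by apply: val_inj; rewrite /= fmM.
Qed.

Definition z (p : nat) : Hxy := gx ^+ p.-1 * gy.

(* z_{p n} z_{p (n-1)} ... z_{p 1}: indices are 1-based and decreasing. *)
Definition zword (n : nat) (p : nat -> nat) : Hxy := \prod_(i < n) z (p (n - i)%N).

Definition H0 (f : Hxy) : Prop :=
  exists (q : rat) (g : Hxy), f = q%:A + gx * g * gy.

Fixpoint shw (u : seq bool) : seq bool -> Hxy :=
  match u with
  | [::] => fun v => gword v
  | a :: u' =>
      fix shu (v : seq bool) : Hxy :=
        match v with
        | [::] => gword u
        | b :: v' => gword [:: a] * shw u' v + gword [:: b] * shu v'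
        end
  end.

Definition sh (f g : Hxy) : Hxy :=
  \sum_(u <- msupp f) \sum_(v <- msupp g) (mcoeff u f * mcoeff v g) *: shw u v.

Lemma sh_gword (u v : seq bool) : sh (gword u) (gword v) = shw u v.
Proof.
by rewrite /sh /gword !msuppU1 !big_seq_fset1 !mcoeffUU mulr1 scale1r.
Qed.

Definition mzv (R : realType) (ks : seq nat) : R :=
  fine (\esum_(m in [set m : (size ks).-tuple nat |
           (forall i, (0 < tnth m i)%N) /\
           (forall i j : 'I_(size ks), (i < j)%N -> (tnth m j < tnth m i)%N)])
         (\prod_(i < size ks) (tnth m i)%:R ^- nth 0%N ks i)%:E).

(* x^{k_1-1} y x^{k_2-1} y ... is read off as [:: k_1; k_2; ...]; the
   accumulator is 1 + the number of x's read since the last y. *)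
Fixpoint wexps (acc : nat) (w : seq bool) : seq nat :=
  match w with
  | [::] => [::]
  | true :: w' => acc :: wexps 1 w'
  | false :: w' => wexps acc.+1 w'
  end.

(* The linear extension is total on Hxy for convenience; only its values on H0
   are meaningful. *)
Definition Z (R : realType) (f : Hxy) : R :=
  mmap (@ratr R) (fun w : fmonom bool => mzv R (wexps 1 w)) f.

Lemma Z_linear (R : realType) (t : rat) (f g : Hxy) :
  Z R (t *: f + g) = ratr t * Z R f + Z R g.
Proof.
rewrite /Z mmapD; congr (_ + _).
rewrite (mmapEw (msuppZ_le _ _)) mmapE mulr_sumr; apply: eq_bigr => w _.
by rewrite mcoeffZ /= rmorphM -mulrA.
Qed.

Lemma Z_gword (R : realType) (s : seq bool) :
  Z R (gword s) = mzv R (wexps 1 s).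
Proof. by rewrite /Z /gword mmapU /= rmorph1 mul1r. Qed.

Lemma Z1 (R : realType) : Z R 1 = 1.
Proof.
rewrite -gword1 Z_gword /mzv /=.
rewrite (_ : [set _ | _] = [set [tuple]]); last first.
  apply/seteqP; split=> m /=; first by rewrite [m]tuple0.
  by move=> _; split; case.
by rewrite esum_set1 big_ord0.
Qed.

Lemma gword_nseqx (n : nat) : gword (nseq n false) = gx ^+ n.
Proof. by elim: n => [|n IHn]; rewrite ?gword1// exprS -IHn -gwordM. Qed.

Lemma Z_zprod (R : realType) (ks : seq nat) : all (leq 1) ks ->
  Z R (\prod_(k <- ks) z k) = mzv R ks.
Proof.
move=> ks1; have wE n acc s : wexps acc (nseq n false ++ s) = wexps (acc + n) s.
  by elim: n acc => [|n IHn] acc /=; rewrite ?addn0// IHn addSnnS.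
rewrite -[in RHS](_ : wexps 1 (flatten [seq nseq k.-1 false ++ [:: true] | k <- ks]) = ks).
  rewrite -Z_gword; congr (Z R _); elim: ks {ks1} => [|k ks IHks] /=.
    by rewrite big_nil gword1.
  by rewrite big_cons IHks gwordM gwordM gword_nseqx.
elim: ks ks1 => //= k ks IHks /andP[k0 /IHks ksE].
by rewrite -catA wE /= ksE add1n prednK.
Qed.

Definition posvec (N : nat) : set {ffun 'I_N -> nat} :=
  [set l | forall k, (0 < l k)%N].

(* \sum_{k=i}^{N+i-j} l_k; the ordinal k stands for the 1-based index k.+1. *)
Definition linform (R : realType) (N : nat) (l : {ffun 'I_N -> nat})
    (ij : nat * nat) : R :=
  \sum_(k < N | (ij.1 <= k.+1 <= N + ij.1 - ij.2)%N) (l k)%:R.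

(* Exponents are families s_{ij}, 1 <= i <= j <= N; values outside this range
   are never used. *)
Definition zterm (R : realType) (N : nat) (s : nat -> nat -> nat)
    (l : {ffun 'I_N -> nat}) : R :=
  \prod_(1 <= i < N.+1) \prod_(i <= j < N.+1) linform R l (i, j) ^- s i j.

Definition zetaA_cvg (R : realType) (N : nat) (s : nat -> nat -> nat) : Prop :=
  summable (@posvec N) (fun l => (zterm R s l)%:E).

Definition zetaA (R : realType) (N : nat) (s : nat -> nat -> nat) : R :=
  fine (\esum_(l in @posvec N) (zterm R s l)%:E).

Definition dA (a b c : nat) (p q r : nat -> nat) (i j : nat) : nat :=
  if (i == 1)%N && (1 <= j <= c)%N then r (c + 1 - j)%N
  else if (i == 1)%N && (b + c + 1 <= j <= a + b + c)%N then
    p (a + b + c + 1 - j)%N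
  else if (i == a + 1)%N && (a + c + 1 <= j <= a + b + c)%N then
    q (a + b + c + 1 - j)%N
  else 0%N.

Definition spp_word (a b c : nat) (p q r : nat -> nat) : Hxy :=
  zword c r * sh (zword a p) (zword b q).

Definition spp_left (a b c : nat) (p q r : nat -> nat) (tau : nat) : Hxy :=
  zword c r * z (p a + tau)
    * sh (zword a.-1 p) (z (q b - tau) * zword b.-1 q).

Definition spp_right (a b c : nat) (p q r : nat -> nat) (tau : nat) : Hxy :=
  zword c r * z (q b + tau)
    * sh (z (p a - tau) * zword a.-1 p) (zword b.-1 q).

Definition set_at (n v : nat) (q : nat -> nat) (i : nat) : nat :=
  if i == n then v else q i.

(* (v, r_1, r_2, ...): the new letter is the rightmost one of the prefix
   z_{r_c} ... z_{r_1} z_v. *)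
Definition ins_first (v : nat) (r : nat -> nat) (i : nat) : nat :=
  if (i == 1)%N then v else r i.-1.

(* Exponents attached by [dA] to the words [spp_left] and [spp_right]. *)
Definition dA_left (a b c : nat) (p q r : nat -> nat) (tau : nat) :=
  dA a.-1 b c.+1 p (set_at b (q b - tau) q) (ins_first (p a + tau) r).

Definition dA_right (a b c : nat) (p q r : nat -> nat) (tau : nat) :=
  dA a b.-1 c.+1 (set_at a (p a - tau) p) q (ins_first (q b + tau) r).

Definition pfd_rhs (R : realType) (alpha beta : nat) (X Y : R) : R :=
  \sum_(tau < beta) 'C(alpha - 1 + tau, tau)%:R
     * ((X + Y) ^- (alpha + tau) * Y ^- (beta - tau))
  + \sum_(tau < alpha) 'C(beta - 1 + tau, tau)%:R
     * ((X + Y) ^- (beta + tau) * X ^- (alpha - tau)).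

Definition zrest (R : realType) (N : nat) (s : nat -> nat -> nat)
    (u v : nat * nat) (l : {ffun 'I_N -> nat}) : R :=
  \prod_(1 <= i < N.+1) \prod_(i <= j < N.+1 | ((i, j) != u) && ((i, j) != v))
     linform R l (i, j) ^- s i j.

Definition vperm (N : nat) (pi : 'S_N) (l : {ffun 'I_N -> nat}) :
  {ffun 'I_N -> nat} := [ffun k => l (pi k)].

(* [pfd_step R N u v s s1 s2]: let X, Y be the linear forms at the positions u, v
   in the series zeta_N(s; A_N), and alpha, beta their exponents.  Replacing
   1 / (X^alpha Y^beta) inside the series by its partial fraction
   decomposition yields
     \sum_(tau < beta)  'C(alpha-1+tau, tau) zeta_N(s1 tau; A_N)
   + \sum_(tau < alpha) 'C(beta-1+tau, tau)  zeta_N(s2 tau; A_N):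
   each resulting series is, up to a renaming of the summation variables
   l_1, ..., l_N, termwise the series of the corresponding zeta value. *)
Definition pfd_step (R : realType) (N : nat) (u v : nat * nat)
    (s : nat -> nat -> nat) (s1 s2 : nat -> nat -> nat -> nat) : Prop :=
  let alpha := s u.1 u.2 in
  let beta := s v.1 v.2 in
  let X := fun l : {ffun 'I_N -> nat} => linform R l u in
  let Y := fun l : {ffun 'I_N -> nat} => linform R l v in
  [/\ [/\ (1 <= u.1 <= u.2)%N, (u.2 <= N)%N, (1 <= v.1 <= v.2)%N,
          (v.2 <= N)%N & u != v],
      (0 < alpha)%N /\ (0 < beta)%N,
      (forall l, posvec l ->
         zterm R s l = zrest R s u v l * (X l ^- alpha * Y l ^- beta) /\
         X l ^- alpha * Y l ^- beta = pfd_rhs alpha beta (X l) (Y l)),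
      (forall tau : nat, (tau < beta)%N -> exists pi : 'S_N,
         forall l, posvec l ->
         zrest R s u v l
           * ((X l + Y l) ^- (alpha + tau) * Y l ^- (beta - tau))
         = zterm R (s1 tau) (vperm pi l)) &
      (forall tau : nat, (tau < alpha)%N -> exists pi : 'S_N,
         forall l, posvec l ->
         zrest R s u v l
           * ((X l + Y l) ^- (beta + tau) * X l ^- (alpha - tau))
         = zterm R (s2 tau) (vperm pi l))].

(* Main.v *)
Require Import Defs.
From mathcomp Require Import all_boot all_order all_algebra all_fingroup.
From mathcomp Require Import all_classical all_reals sequences esum.
From mathcomp Require Import -(notations) monalg.
From mathcomp Require Import zify ring lra.

Set Implicit Arguments.
Unset Strict Implicit.
Unset Printing Implicit Defensive.

Import Order.TTheory GRing.Theory Num.Theory.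

Local Open Scope classical_set_scope.
Local Open Scope ring_scope.

(** Both sides of the evaluation obey one and the same recursion.  On words,
    comparing first letters shows that the shuffle product F(p, q) of
    x^(p-1) y u and x^(q-1) y v satisfies F(p, q) = x F(p-1, q) + x F(p, q-1)
    for p, q > 1; on numbers, F(p, q) = 1 / (X^p Y^q) satisfies the same
    relation with 1 / (X + Y) in place of x.  [two_sided_recursion] solves the
    recursion in an arbitrary ring by Pascal's rule; its two instances are the
    step of the shuffle product procedure ([shw_expand], [spp_expansion]) and
    the partial fraction decomposition ([pfd_rhsE]).

    For the exponents [dA a b c p q r] the summand of the zeta value is a product
    over three chains of consecutive sums ([zterm_dA]): the sums l_1 + ... + l_k
    for k <= a with exponents p_k, the sums l_(a+1) + ... + l_(a+k) for k <= b
    with exponents q_k, and the sums l_1 + ... + l_(a+b+k) for k <= c with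
    exponents r_k.  A decomposition step is applied to the last terms X and Y of
    the first two chains.  Since X + Y = l_1 + ... + l_(a+b), it becomes the new
    first term of the third chain.  When X has disappeared, moving the variable
    l_a behind l_(a+b) turns the summand into that of [dA_left]; when Y has
    disappeared the summand is that of [dA_right] as it stands
    ([pfd_step_dA]).  All summands are nonnegative, so the termwise identity may
    be summed, and convergence of the given series forces convergence of all
    resulting ones ([pfd_step_zetaA]).

    Each step lowers a + b, so the evaluation follows by induction
    ([Z_spp_word]) from the case a = 0 or b = 0.  There is then nothing to
    shuffle and only one chain is left, and the substitution
    m_i = l_1 + ... + l_(N+1-i) identifies the multiple zeta value with the
    zeta value of the root system ([partial_sums_bij]).

    Membership in H^0 amounts to the leading exponents being at least 2.  If one
    of them were 1, then the variable that occurs in the corresponding sum only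
    could be let run with all others equal to 1, and the series would dominate
    a multiple of the harmonic series ([zetaA_dvg]). *)

(** * The recursion common to shuffles and partial fractions *)

(** The part of the solution of [two_sided_recursion] that comes from the
    boundary values [G]: it obeys the recursion with no source at q = 0. *)
Lemma half_binomial_recursion (A : pzRingType) (t : A) (G : nat -> A) (p q : nat) :
  let S p q := \sum_(tau < q.+1) (t ^+ (p + tau) * G (q - tau)%N) *+ 'C(p + tau, tau) in
  S p q = (if p is p'.+1 then t * S p' q else G q)
        + (if q is q'.+1 then t * S p q' else 0).
Proof.
move=> S; rewrite /S {S}; case: p => [|p]; case: q => [|q].
- by rewrite big_ord1 /= addr0 mul1r subn0 mulr1n.
- rewrite big_ord_recl /= mul1r subn0 mulr1n mulr_sumr; congr (_ + _).
  apply: eq_bigr => i _; rewrite !add0n !binn !mulr1n /bump /= add1n.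
  by rewrite exprS mulrA subSS.
- by rewrite !big_ord1 /= !addn0 !bin0 !mulr1n addr0 exprS mulrA.
- rewrite big_ord_recl [in RHS]big_ord_recl /= !addn0 !bin0 !mulr1n.
  rewrite mulrDr mulrA -exprS -addrA; congr (_ + _).
  rewrite !mulr_sumr -big_split; apply: eq_bigr => i _ /=.
  rewrite /bump /= add1n addSn binS mulrnDr subSS exprS -mulrA.
  by rewrite -!mulrnAr addSnnS.
Qed.

(** In both applications the indices are the exponents minus 1, so that
    [G] and [H] are the contributions in which one exponent has dropped to 0. *)
Lemma two_sided_recursion (A : pzRingType) (t : A) (F : nat -> nat -> A)
    (G H : nat -> A) :
  (forall p q, F p q = (if p is p'.+1 then t * F p' q else G q)
                     + (if q is q'.+1 then t * F p q' else H p)) ->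
  forall p q, F p q
  = \sum_(tau < q.+1) (t ^+ (p + tau) * G (q - tau)%N) *+ 'C(p + tau, tau)
  + \sum_(tau < p.+1) (t ^+ (q + tau) * H (p - tau)%N) *+ 'C(q + tau, tau).
Proof.
move=> Frec p q; elim: {p q}(p + q)%N {-2}p {-2}q (leqnn (p + q)) => [|n IHn] p q le_n.
  case: p q le_n => [|p] [|q] // _.
  by rewrite Frec !big_ord1 /= !mul1r !mulr1n.
rewrite Frec half_binomial_recursion [X in _ = _ + X]half_binomial_recursion.
case: p q le_n => [|p] [|q] le_n.
- by rewrite addr0 addr0.
- by rewrite (IHn 0 q) ?mulrDr ?addr0 1?addrA //; lia.
- by rewrite (IHn p 0) ?mulrDr ?addr0 -?addrA 1?[X in _ + X]addrC //; try lia.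
- rewrite (IHn p q.+1) 1?(IHn p.+1 q) ?mulrDr; try lia.
  by rewrite [X in _ = _ + X]addrC addrACA.
Qed.

(** * One step of the shuffle product procedure *)

(** The exponents p_n, ..., p_1 of [zword n p], in this order. *)
Definition zexps (n : nat) (p : nat -> nat) : seq nat :=
  [seq p (n - i)%N | i <- iota 0 n].

(** The letters of z_(k_1) z_(k_2) ..., with [false] for x and [true]
    for y. *)
Definition zletters (ks : seq nat) : seq bool :=
  flatten [seq nseq k.-1 false ++ [:: true] | k <- ks].

Lemma eq_zword (n : nat) (p p' : nat -> nat) :
  (forall i, (1 <= i <= n)%N -> p i = p' i) -> zword n p = zword n p'.
Proof.
by move=> pp'; apply: eq_bigr => i _; rewrite pp' //; have := ltn_ord i; lia.
Qed.

Lemma zword0 (p : nat -> nat) : zword 0 p = 1.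
Proof. by rewrite /zword big_ord0. Qed.

Lemma zwordS (n : nat) (p : nat -> nat) :
  zword n.+1 p = z (p n.+1) * zword n p.
Proof.
by rewrite /zword big_ord_recl subn0; congr (_ * _); apply: eq_bigr => i _.
Qed.

Lemma prod_countdown_cat (A : pzSemiRingType) (m n : nat) (f g : nat -> A) :
  \prod_(i < m) f (m - i)%N * \prod_(i < n) g (n - i)%N
  = \prod_(i < m + n)
      (fun k => if (k <= n)%N then g k else f (k - n)%N) (m + n - i)%N.
Proof.
rewrite [RHS]big_split_ord /=; congr (_ * _).
  by apply: eq_bigr => i _; have lt_i := ltn_ord i; rewrite ifF;
     [congr f |]; lia.
by apply: eq_bigr => i _; have lt_i := ltn_ord i; rewrite ifT;
   [congr g |]; lia.
Qed.

Lemma zwordD (m n : nat) (p q : nat -> nat) :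
  zword m p * zword n q
  = zword (m + n) (fun i => if (i <= n)%N then q i else p (i - n)%N).
Proof.
transitivity (\prod_(i < m + n) (fun k => if (k <= n)%N then z (q k)
                                  else z (p (k - n)%N)) (m + n - i)%N).
  exact: (@prod_countdown_cat _ m n (fun i => z (p i)) (fun i => z (q i))).
by apply: eq_bigr => i _; case: ifP.
Qed.

Lemma prod_countdown_recr (A : pzSemiRingType) (n : nat) (f g : nat -> A) :
  (forall i, (0 < i)%N -> g i.+1 = f i) ->
  \prod_(i < n.+1) g (n.+1 - i)%N = \prod_(i < n) f (n - i)%N * g 1%N.
Proof.
move=> gf; rewrite big_ord_recr /= subSnn; congr (_ * _).
by apply: eq_bigr => i _; rewrite subSn 1?ltnW // gf // subn_gt0.
Qed.

Lemma zword_ins_first (c v : nat) (r : nat -> nat) :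
  zword c.+1 (ins_first v r) = zword c r * z v.
Proof.
have ins i : (0 < i)%N -> ins_first v r i.+1 = r i by case: i.
exact: (@prod_countdown_recr _ c (fun i => z (r i)) (fun i => z (ins_first v r i))
  (fun i i0 => congr1 z (ins i i0))).
Qed.

Lemma zword_prod (N : nat) (e : nat -> nat) :
  zword N e = \prod_(k <- zexps N e) z k.
Proof. by rewrite /zexps big_map -{2}[N]subn0 big_mkord. Qed.

Lemma zE (k : nat) : z k = gx ^+ k.-1 * gy.
Proof. by []. Qed.

Lemma spp_left_def (a b c : nat) (p q r : nat -> nat) (tau : nat) :
  spp_left a b c p q r tau = zword c r * z (p a + tau)
    * sh (zword a.-1 p) (z (q b - tau) * zword b.-1 q).
Proof. by []. Qed.

Lemma spp_right_def (a b c : nat) (p q r : nat -> nat) (tau : nat) :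
  spp_right a b c p q r tau = zword c r * z (q b + tau)
    * sh (z (p a - tau) * zword a.-1 p) (zword b.-1 q).
Proof. by []. Qed.

(* From here on these are handled through their equations only: comparing two
   different products in the free algebra by conversion would unfold both down
   to their coefficient functions. *)
#[local] Opaque gx gy gword z zword shw sh spp_left spp_right.

Lemma mulr_reassoc4 (A : pzSemiRingType) (s t u v : A) :
  s * (t * u) * v = s * (t * (u * v)).
Proof. by rewrite !mulrA. Qed.

Lemma zword_set_at (b v : nat) (q : nat -> nat) : (0 < b)%N ->
  zword b (set_at b v q) = z v * zword b.-1 q.
Proof.
case: b => // b _.
have setS : set_at b.+1 v q b.+1 = v by rewrite /set_at eqxx.
have set_lt : zword b (set_at b.+1 v q) = zword b q.
  by apply: eq_zword => i ib; rewrite /set_at; case: eqP => //; lia.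
rewrite (zwordS b (set_at b.+1 v q)); rewrite setS; rewrite set_lt.
exact: erefl.
Qed.

Lemma spp_leftE (a b c : nat) (p q r : nat -> nat) (tau : nat) : (0 < b)%N ->
  spp_left a b c p q r tau
  = spp_word a.-1 b c.+1 p (set_at b (q b - tau) q) (ins_first (p a + tau) r).
Proof.
by move=> b0; rewrite spp_left_def /spp_word zword_ins_first zword_set_at.
Qed.

Lemma spp_rightE (a b c : nat) (p q r : nat -> nat) (tau : nat) : (0 < a)%N ->
  spp_right a b c p q r tau
  = spp_word a b.-1 c.+1 (set_at a (p a - tau) p) q (ins_first (q b + tau) r).
Proof.
by move=> a0; rewrite spp_right_def /spp_word zword_ins_first zword_set_at.
Qed.

Lemma z_gword (k : nat) : z k = gword (nseq k.-1 false ++ [:: true]).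
Proof. by rewrite gwordM gword_nseqx. Qed.

Lemma zexpsS (n : nat) (p : nat -> nat) : zexps n.+1 p = p n.+1 :: zexps n p.
Proof.
by rewrite /zexps /= (iotaDl 1 0) -map_comp subn0; congr (_ :: _); apply: eq_map.
Qed.

Lemma zwordE (n : nat) (p : nat -> nat) :
  zword n p = gword (zletters (zexps n p)).
Proof.
elim: n => [|n IHn]; first by rewrite zword0 -gword1.
by rewrite zwordS IHn z_gword -gwordM zexpsS.
Qed.

Lemma shw0r (u : seq bool) : shw u [::] = gword u.
Proof. by case: u. Qed.

Lemma shw_cons (s t : bool) (u v : seq bool) :
  shw (s :: u) (t :: v)
  = gword [:: s] * shw u (t :: v) + gword [:: t] * shw (s :: u) v.
Proof. by []. Qed.

(** The shuffle step for words, before the common prefix is put in front;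
    the first blocks are z_(P+1) and z_(Q+1). *)
Lemma shw_expand (u v : seq bool) (P Q : nat) :
  shw (nseq P false ++ true :: u) (nseq Q false ++ true :: v)
  = \sum_(tau < Q.+1) (gx ^+ (P + tau)
       * (gy * shw u (nseq (Q - tau) false ++ true :: v))) *+ 'C(P + tau, tau)
  + \sum_(tau < P.+1) (gx ^+ (Q + tau)
       * (gy * shw (nseq (P - tau) false ++ true :: u) v)) *+ 'C(Q + tau, tau).
Proof.
pose F P Q := shw (nseq P false ++ true :: u) (nseq Q false ++ true :: v).
apply: (two_sided_recursion (F := F)
  (G := fun n => gy * shw u (nseq n false ++ true :: v))
  (H := fun n => gy * shw (nseq n false ++ true :: u) v)) => {P Q} P Q.
by case: P => [|P]; case: Q => [|Q]; rewrite /F !shw_cons.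
Qed.

Lemma spp_wordE (a b c : nat) (p q r : nat -> nat) :
  spp_word a b c p q r
  = zword c r * shw (zletters (zexps a p)) (zletters (zexps b q)).
Proof. by rewrite /spp_word !zwordE sh_gword. Qed.

Lemma z_mul_gword (k : nat) (w : seq bool) :
  z k * gword w = gword (nseq k.-1 false ++ true :: w).
Proof. by rewrite z_gword -gwordM -catA. Qed.

Lemma sh_gword_z (k : nat) (u w : seq bool) :
  sh (gword u) (z k * gword w) = shw u (nseq k.-1 false ++ true :: w).
Proof. by rewrite -sh_gword -z_mul_gword. Qed.

Lemma sh_z_gword (k : nat) (u w : seq bool) :
  sh (z k * gword w) (gword u) = shw (nseq k.-1 false ++ true :: w) u.
Proof. by rewrite -sh_gword -z_mul_gword. Qed.

Lemma zletters_cons (k : nat) (ks : seq nat) :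
  zletters (k :: ks) = nseq k.-1 false ++ true :: zletters ks.
Proof. by rewrite /zletters /= -catA. Qed.

Lemma spp_expansion (a b c : nat) (p q r : nat -> nat) :
  (0 < a)%N -> (0 < b)%N -> (0 < p a)%N -> (0 < q b)%N ->
  spp_word a b c p q r
    = \sum_(tau < q b) 'C(p a - 1 + tau, tau)%:R *: spp_left a b c p q r tau
    + \sum_(tau < p a) 'C(q b - 1 + tau, tau)%:R *: spp_right a b c p q r tau.
Proof.
case: a => // a; case: b => // b _ _ pa qb.
pose U := zletters (zexps a p); pose V := zletters (zexps b q).
pose x_y k w := nseq k false ++ true :: w.
have leftE (tau : 'I_(q b.+1)) : spp_left a.+1 b.+1 c p q r tau
    = zword c r * (gx ^+ ((p a.+1).-1 + tau)
        * (gy * shw U (x_y ((q b.+1).-1 - tau)%N V))).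
  have lt_tau := ltn_ord tau; rewrite spp_left_def /=.
  rewrite (zwordE a p) (zwordE b q) sh_gword_z zE.
  have -> : (p a.+1 + tau).-1 = ((p a.+1).-1 + tau)%N by lia.
  have -> : (q b.+1 - tau).-1 = ((q b.+1).-1 - tau)%N by lia.
  exact: mulr_reassoc4.
have rightE (tau : 'I_(p a.+1)) : spp_right a.+1 b.+1 c p q r tau
    = zword c r * (gx ^+ ((q b.+1).-1 + tau)
        * (gy * shw (x_y ((p a.+1).-1 - tau)%N U) V)).
  have lt_tau := ltn_ord tau; rewrite spp_right_def /=.
  rewrite (zwordE a p) (zwordE b q) sh_z_gword zE.
  have -> : (q b.+1 + tau).-1 = ((q b.+1).-1 + tau)%N by lia.
  have -> : (p a.+1 - tau).-1 = ((p a.+1).-1 - tau)%N by lia.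
  exact: mulr_reassoc4.
rewrite spp_wordE (zexpsS a) (zexpsS b).
rewrite [zletters (_ :: zexps a p)]zletters_cons.
rewrite [zletters (_ :: zexps b q)]zletters_cons.
rewrite shw_expand !prednK // mulrDr !mulr_sumr.
by congr (_ + _); apply: eq_bigr => tau _;
   rewrite ?leftE ?rightE scaler_nat subn1 mulrnAr.
Qed.

(** * Factorisation of the summand into chains *)

(** The sum of the [n] consecutive variables of which the first has
    0-based index [i], that is l_(i+1) + ... + l_(i+n). *)
Definition psum (R : realType) (N : nat) (l : {ffun 'I_N -> nat}) (i n : nat) : R :=
  \sum_(k < N | (i <= k < i + n)%N) (l k)%:R.

Lemma eq_zterm (R : realType) (N : nat) (s s' : nat -> nat -> nat)
    (l : {ffun 'I_N -> nat}) :
  (forall i j, (1 <= i)%N -> (i <= j <= N)%N -> s i j = s' i j) ->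
  zterm R s l = zterm R s' l.
Proof.
move=> ss'; apply: eq_big_nat => i /andP[i1 _].
by apply: eq_big_nat => j ij; rewrite ss'.
Qed.

Lemma ztermD (R : realType) (N : nat) (s s' : nat -> nat -> nat)
    (l : {ffun 'I_N -> nat}) :
  zterm R (fun i j => s i j + s' i j)%N l = zterm R s l * zterm R s' l.
Proof.
rewrite /zterm -big_split; apply: eq_bigr => i _.
by rewrite -big_split; apply: eq_bigr => j _ /=; rewrite exprD invfM.
Qed.

(** Exponents carried by the positions lo, ..., hi of a single row i0.  The
    product is indexed from the last position down, so that the sums involved
    increase. *)
Lemma zterm_segment (R : realType) (N i0 lo hi : nat) (e : nat -> nat)
    (l : {ffun 'I_N -> nat}) : (0 < i0 <= lo)%N -> (hi <= N)%N ->
  zterm R (fun i j => if (i == i0) && (lo <= j <= hi)%N then e (hi + 1 - j)%N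
                      else 0%N) l
  = \prod_(k < hi.+1 - lo) linform R l (i0, (hi - k)%N) ^- e k.+1.
Proof.
move=> /andP[i00 i0lo] hiN; rewrite /zterm.
pose f j : R := linform R l (i0, j) ^- e (hi + 1 - j)%N.
have inner i : \prod_(i <= j < N.+1) linform R l (i, j) ^-
    (if (i == i0) && (lo <= j <= hi)%N then e (hi + 1 - j)%N else 0%N)
    = if i == i0 then \prod_(lo <= j < hi.+1) f j else 1.
  case: eqP => [->|_] /=; last by rewrite big1 // => j _; rewrite expr0 invr1.
  rewrite (big_nat_widenl _ _ _ _ _ i0lo) (@big_nat_widen _ _ _ i0 hi.+1 N.+1) //.
  rewrite [RHS]big_mkcond; apply: eq_bigr => j _ /=; rewrite ltnS.
  by case: ifP => // _; rewrite expr0 invr1.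
rewrite (eq_bigr _ (fun i _ => inner i)) -big_mkcond big_nat1_eq.
have seg : \prod_(lo <= j < hi.+1) f j =
    \prod_(k < hi.+1 - lo) linform R l (i0, (hi - k)%N) ^- e k.+1.
  rewrite big_nat_rev -{1}[lo]add0n big_addn big_mkord; apply: eq_bigr => k _.
  rewrite /f; have lt_k := ltn_ord k.
  by congr (linform R l (_, _) ^- e _); lia.
case: ifP => // i0N; rewrite (_ : hi.+1 - lo = 0)%N ?big_ord0 //; lia.
Qed.

(** The three factors are the chains of the words in p, q and r.  The cases
    a = 0 and b = 0 are included. *)
Lemma zterm_dA (R : realType) (N a b c : nat) (p q r : nat -> nat)
    (l : {ffun 'I_N -> nat}) : N = (a + b + c)%N ->
  zterm R (dA a b c p q r) l
  = \prod_(k < a) psum R l 0 k.+1 ^- p k.+1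
    * \prod_(k < b) psum R l a k.+1 ^- q k.+1
    * \prod_(k < c) psum R l 0 (a + b + k.+1) ^- r k.+1.
Proof.
move=> defN.
(* The conditions in [dA] exclude each other, so that its exponents are sums
   of exponents that are each supported by one row. *)
pose dr i j := if (i == 1%N) && (1 <= j <= c)%N then r (c + 1 - j)%N else 0%N.
pose dp i j := if (i == 1%N) && (b + c + 1 <= j <= N)%N then p (N + 1 - j)%N
               else 0%N.
pose dq i j := if (i == a + 1)%N && (a + c + 1 <= j <= N)%N then q (N + 1 - j)%N
               else 0%N.
rewrite (@eq_zterm _ _ _ (fun i j => dp i j + dq i j + dr i j)%N); last first.
  move=> i j i1 ij; rewrite /dA /dp /dq /dr -defN.
  case: (ifP ((i == 1) && (1 <= j <= c)))%N => h1.
    by rewrite !ifF //; lia.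
  case: (ifP ((i == 1) && (b + c + 1 <= j <= N)))%N => h2.
    by rewrite ifF ?addn0 //; lia.
  by rewrite add0n addn0.
rewrite !ztermD !zterm_segment; try lia.
have -> : (N.+1 - (b + c + 1) = a)%N by lia.
have -> : (N.+1 - (a + c + 1) = b)%N by lia.
rewrite subn1 /=.
congr (_ * _ * _); apply: eq_bigr => k _; have lt_k := ltn_ord k;
  by congr (_ ^- _); apply: eq_bigl => j /=; lia.
Qed.

Lemma zrest_zterm (R : realType) (N : nat) (s : nat -> nat -> nat)
    (u v : nat * nat) (l : {ffun 'I_N -> nat}) :
  zrest R s u v l
  = zterm R (fun i j => if ((i, j) != u) && ((i, j) != v) then s i j else 0%N) l.
Proof.
apply: eq_bigr => i _; rewrite big_mkcond; apply: eq_bigr => j _.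
by case: ifP => // _; rewrite expr0 invr1.
Qed.

(** The exponents are written as those of [zrest] plus those at u and v,
    and [zterm] turns sums of exponents into products. *)
Lemma zterm_split (R : realType) (N : nat) (s : nat -> nat -> nat)
    (u v : nat * nat) (l : {ffun 'I_N -> nat}) :
  (1 <= u.1 <= u.2)%N -> (u.2 <= N)%N -> (1 <= v.1 <= v.2)%N -> (v.2 <= N)%N ->
  u != v ->
  zterm R s l
  = zrest R s u v l * (linform R l u ^- s u.1 u.2 * linform R l v ^- s v.1 v.2).
Proof.
case: u v => [u1 u2] [v1 v2] /= u12 u2N v12 v2N neq_uv.
pose s0 i j := if ((i, j) != (u1, u2)) && ((i, j) != (v1, v2)) then s i j else 0%N.
pose d w1 w2 i j := if (i == w1) && (w2 <= j <= w2)%N then s w1 w2 else 0%N.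
rewrite (@eq_zterm _ _ _ (fun i j => s0 i j + (d u1 u2 i j + d v1 v2 i j))%N);
  last first.
  move=> i j _ _.
  have dE w1 w2 : d w1 w2 i j = if (i, j) == (w1, w2) then s w1 w2 else 0%N.
    by rewrite /d -eqn_leq xpair_eqE [w2 == j]eq_sym.
  rewrite /s0 !dE; case: eqVneq => [[-> ->]|_] /=.
    by rewrite (negPf neq_uv) addn0.
  by case: eqVneq => [[-> ->]|_] /=; rewrite ?addn0.
rewrite zrest_zterm ztermD; congr (_ * _).
rewrite ztermD (@zterm_segment _ _ u1 u2 u2 (fun=> s u1 u2)); try lia.
rewrite (@zterm_segment _ _ v1 v2 v2 (fun=> s v1 v2)); try lia.
by rewrite !subSnn !big_ord1 !subn0.
Qed.

Lemma zrest_dA (R : realType) (N a b c : nat) (p q r : nat -> nat)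
    (l : {ffun 'I_N -> nat}) : N = (a + b + c)%N -> (0 < a)%N -> (0 < b)%N ->
  zrest R (dA a b c p q r) (1%N, (b + c + 1)%N) ((a + 1)%N, (a + c + 1)%N) l
  = \prod_(k < a.-1) psum R l 0 k.+1 ^- p k.+1
    * \prod_(k < b.-1) psum R l a k.+1 ^- q k.+1
    * \prod_(k < c) psum R l 0 (a + b + k.+1) ^- r k.+1.
Proof.
move=> defN a0 b0; rewrite zrest_zterm.
(* Leaving out the positions of X and Y amounts to exponents p_a = q_b = 0. *)
rewrite (@eq_zterm _ _ _ (dA a b c (set_at a 0 p) (set_at b 0 q) r)); last first.
  move=> i j i1 ij; rewrite /dA /set_at !xpair_eqE.
  case: (ifP ((i == 1) && (1 <= j <= c)))%N => h1; first by rewrite ifT //; lia.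
  case: (ifP ((i == 1) && (b + c + 1 <= j <= _)))%N => h2.
    have -> : ((a + b + c + 1 - j == a) = (j == b + c + 1))%N by lia.
    by case: (j =P (b + c + 1)%N) => jE; [rewrite ifF | rewrite ifT]; lia.
  case: (ifP ((i == a + 1) && (a + c + 1 <= j <= _)))%N => h3; last by case: ifP.
  have -> : ((a + b + c + 1 - j == b) = (j == a + c + 1))%N by lia.
  by case: (j =P (a + c + 1)%N) => jE; [rewrite ifF | rewrite ifT]; lia.
rewrite zterm_dA //; case: a b a0 b0 {defN} => [|a] [|b] //= _ _.
rewrite big_ord_recr /= [X in _ * X * _]big_ord_recr /= /set_at !eqxx.
rewrite !expr0 !invr1 !mulr1; congr (_ * _ * _); apply: eq_bigr => k _;
  by rewrite ifF // eqSS; apply/negbTE; rewrite neq_ltn ltn_ord.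
Qed.

(** * Partial fraction decomposition of the summand *)

Lemma pfd_rhsE (R : realType) (alpha beta : nat) (X Y : R) :
  (0 < alpha)%N -> (0 < beta)%N -> X != 0 -> Y != 0 -> X + Y != 0 ->
  X ^- alpha * Y ^- beta = pfd_rhs alpha beta X Y.
Proof.
case: alpha beta => // p [] // q _ _ X0 Y0 XY0.
pose t := (X + Y)^-1.
pose F m n := X ^- m.+1 * Y ^- n.+1.
have Frec m n : F m n = (if m is m'.+1 then t * F m' n else t * Y ^- n.+1)
                      + (if n is n'.+1 then t * F m n' else t * X ^- m.+1).
  have split_t (u v : R) : X^-1 * u * (Y^-1 * v) = t * (u * (Y^-1 * v))
                                        + t * (X^-1 * u * v).
    by rewrite /t; field; rewrite X0 Y0 XY0.
  rewrite /F; case: m n => [|m] [|n]; rewrite -!exprVn ?(exprS _ _.+1) ?expr1.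
  - by have := split_t 1 1; rewrite !mulr1 mul1r.
  - by have := split_t 1 (Y^-1 ^+ n.+1); rewrite !mulr1 mul1r.
  - by have := split_t (X^-1 ^+ m.+1) 1; rewrite !mulr1.
  - exact: split_t.
rewrite -/(F p q) (two_sided_recursion (t := t) (F := F) Frec) /pfd_rhs.
by congr (_ + _); apply: eq_bigr => i _; have lt_i := ltn_ord i;
  rewrite subn1 /= mulr_natl mulrA -exprSr addSn -addSn subSn // -!exprVn.
Qed.

Lemma psumD (R : realType) (N : nat) (l : {ffun 'I_N -> nat}) (i m n : nat) :
  psum R l i (m + n) = psum R l i m + psum R l (i + m) n.
Proof.
rewrite /psum (bigID (fun k : 'I_N => (k < i + m)%N)) /=.
by congr (_ + _); apply: eq_bigl => k; lia.
Qed.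

Lemma psum_gt0 (R : realType) (N : nat) (l : {ffun 'I_N -> nat}) (i n : nat) :
  posvec l -> (i < N)%N -> (0 < n)%N -> 0 < psum R l i n.
Proof.
move=> l0 iN n0; rewrite /psum (bigD1 (Ordinal iN)) /=; last by lia.
by apply: ltr_pwDl; rewrite ?ltr0n ?l0 // sumr_ge0.
Qed.

Lemma linform_ge0 (R : realType) (N : nat) (l : {ffun 'I_N -> nat})
  (u : nat * nat) : 0 <= linform R l u.
Proof. exact: sumr_ge0. Qed.

Lemma zterm_ge0 (R : realType) (N : nat) (s : nat -> nat -> nat)
  (l : {ffun 'I_N -> nat}) : 0 <= zterm R s l.
Proof.
do 2! [apply: prodr_ge0 => ? _]; rewrite invr_ge0 exprn_ge0 //.
exact: linform_ge0.
Qed.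

Lemma psum_vperm (R : realType) (N : nat) (pi : 'S_N) (l : {ffun 'I_N -> nat})
    (i j n : nat) :
  (forall k, (j <= pi k < j + n)%N = (i <= k < i + n)%N) ->
  psum R (vperm pi l) i n = psum R l j n.
Proof.
move=> pij; rewrite /psum [RHS](reindex_inj (@perm_inj _ pi)) /=.
by apply: eq_big => [k|k _]; rewrite ?pij ?ffunE.
Qed.

(** The permutation that puts l_a right after l_(a+b) and leaves the other
    variables in order: composing with it lists l_1, ..., l_(a-1), l_(a+1), ...,
    l_(a+b), l_a. *)
Lemma exists_rotation (N a b : nat) : (0 < a)%N -> (a + b <= N)%N ->
  exists pi : 'S_N, forall k : 'I_N, pi k = (if (k < a.-1)%N then val k
    else if (k < a.-1 + b)%N then k.+1
    else if k == (a.-1 + b)%N :> nat then a.-1 else k) :> nat.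
Proof.
move=> a0 abN.
pose f (k : nat) := (if (k < a.-1)%N then k
    else if (k < a.-1 + b)%N then k.+1
    else if k == (a.-1 + b)%N :> nat then a.-1 else k).
have fN (k : 'I_N) : (f k < N)%N.
  by rewrite /f; have lt_k := ltn_ord k; do 3? case: ifP => ?; lia.
have f_inj : injective (fun k => Ordinal (fN k)).
  move=> k k' /(congr1 val) /= fkk'; apply: val_inj; move: fkk'; rewrite /f /=.
  by do 6? case: ifP => ?; lia.
by exists (perm f_inj) => k; rewrite permE.
Qed.

Lemma prod_set_at (R : realType) (b v : nat) (q : nat -> nat) (F : nat -> R) :
  (0 < b)%N ->
  \prod_(k < b) F k.+1 ^- set_at b v q k.+1
  = \prod_(k < b.-1) F k.+1 ^- q k.+1 * F b ^- v.
Proof.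
case: b => // b _; rewrite big_ord_recr /= {2}/set_at eqxx; congr (_ * _).
by apply: eq_bigr => k _; rewrite /set_at eqSS ltn_eqF.
Qed.

Lemma prod_ins_first (R : realType) (c v : nat) (r : nat -> nat) (F : nat -> R) :
  \prod_(k < c.+1) F k.+1 ^- ins_first v r k.+1
  = F 1%N ^- v * \prod_(k < c) F k.+2 ^- r k.+1.
Proof. by rewrite big_ord_recl. Qed.

Lemma dA_at_p (a b c : nat) (p q r : nat -> nat) : (0 < a)%N -> (0 < b)%N ->
  dA a b c p q r 1 (b + c + 1) = p a.
Proof.
move=> a0 b0; rewrite /dA ifF; last by lia.
by rewrite ifT; [congr p |]; lia.
Qed.

Lemma dA_at_q (a b c : nat) (p q r : nat -> nat) : (0 < a)%N -> (0 < b)%N ->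
  dA a b c p q r (a + 1) (a + c + 1) = q b.
Proof.
move=> a0 b0; rewrite /dA ifF; last by lia.
rewrite ifF; last by lia.
by rewrite ifT; [congr q |]; lia.
Qed.

Lemma linform_p (R : realType) (N a b c : nat) (l : {ffun 'I_N -> nat}) :
  N = (a + b + c)%N -> linform R l (1%N, (b + c + 1)%N) = psum R l 0 a.
Proof. by move=> defN; apply: eq_bigl => k /=; have := ltn_ord k; lia. Qed.

Lemma linform_q (R : realType) (N a b c : nat) (l : {ffun 'I_N -> nat}) :
  N = (a + b + c)%N -> linform R l ((a + 1)%N, (a + c + 1)%N) = psum R l a b.
Proof. by move=> defN; apply: eq_bigl => k /=; have := ltn_ord k; lia. Qed.

Lemma pfd_step_dA (R : realType) (N a b c : nat) (p q r : nat -> nat) :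
  N = (a + b + c)%N -> (0 < a)%N -> (0 < b)%N -> (0 < p a)%N -> (0 < q b)%N ->
  pfd_step R N (1%N, (b + c + 1)%N) ((a + 1)%N, (a + c + 1)%N)
    (dA a b c p q r) (dA_left a b c p q r) (dA_right a b c p q r).
Proof.
move=> defN a0 b0 pa qb.
rewrite /pfd_step /= dA_at_p // dA_at_q //; split.
- by split; rewrite ?xpair_eqE; lia.
- by [].
- move=> l l0; rewrite (linform_p _ _ defN) (linform_q _ _ defN); split.
    rewrite (@zterm_split _ _ _ (1, b + c + 1) (a + 1, a + c + 1))%N;
      rewrite ?xpair_eqE /=; try lia.
    by rewrite !(dA_at_p, dA_at_q) // (linform_p _ _ defN) (linform_q _ _ defN).
  have X0 : 0 < psum R l 0 a by apply: psum_gt0 => //; lia.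
  have Y0 : 0 < psum R l a b by apply: psum_gt0 => //; lia.
  by apply: pfd_rhsE => //; rewrite gt_eqF // addr_gt0.
- move=> tau lt_tau; have [|pi piE] := @exists_rotation N a b a0; first lia.
  exists pi => l l0; rewrite (zrest_dA _ _ _ _ _ defN) //.
  rewrite (linform_p _ _ defN) (linform_q _ _ defN).
  have -> : psum R l 0 a + psum R l a b = psum R l 0 (a + b).
    by rewrite psumD add0n.
  rewrite /dA_left (@zterm_dA _ _ a.-1 b c.+1); last by lia.
  rewrite (prod_set_at _ _ (psum R _ _)) //.
  rewrite (prod_ins_first _ _ _ (fun k => psum R _ _ (a.-1 + b + k))).
  have low n : (n <= a.-1)%N -> psum R (vperm pi l) 0 n = psum R l 0 n.
    move=> le_n; apply: psum_vperm => k; rewrite piE /=.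
    by do 3? case: ifP => ?; lia.
  have mid n : (n <= b)%N -> psum R (vperm pi l) a.-1 n = psum R l a n.
    move=> le_n; apply: psum_vperm => k; rewrite piE /=.
    by do 3? case: ifP => ?; lia.
  have top n : (a.-1 + b < n)%N -> psum R (vperm pi l) 0 n = psum R l 0 n.
    move=> le_n; apply: psum_vperm => k; rewrite piE /=.
    by do 3? case: ifP => ?; lia.
  rewrite mid // top; last by lia.
  rewrite [X in _ = X * _ * _](eq_bigr (fun k : 'I_a.-1 => psum R l 0 k.+1 ^- p k.+1));
    last by move=> k _; rewrite low.
  rewrite [X in _ = _ * (X * _) * _](eq_bigr
    (fun k : 'I_b.-1 => psum R l a k.+1 ^- q k.+1)); last first.
    by move=> k _; rewrite mid //; have := ltn_ord k; lia.
  rewrite [X in _ = _ * (_ * X)](eq_bigr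
    (fun k : 'I_c => psum R l 0 (a + b + k.+1) ^- r k.+1)); last first.
    by move=> k _; rewrite top; [congr (psum R l 0 _ ^- _) |]; lia.
  have -> : (a.-1 + b + 1 = a + b)%N by lia.
  by ring.
- move=> tau lt_tau; exists 1%g => l l0.
  rewrite (zrest_dA _ _ _ _ _ defN) // (linform_p _ _ defN) (linform_q _ _ defN).
  have -> : psum R l 0 a + psum R l a b = psum R l 0 (a + b).
    by rewrite psumD add0n.
  have -> : vperm 1 l = l by apply/ffunP => k; rewrite ffunE perm1.
  rewrite /dA_right (@zterm_dA _ _ a b.-1 c.+1); last by lia.
  rewrite (prod_set_at _ _ (psum R _ _)) //.
  rewrite (prod_ins_first _ _ _ (fun k => psum R _ _ (a + b.-1 + k))).
  rewrite [X in _ = _ * (_ * X)](eq_bigr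
    (fun k : 'I_c => psum R l 0 (a + b + k.+1) ^- r k.+1)); last first.
    by move=> k _; congr (psum R l 0 _ ^- _); lia.
  have -> : (a + b.-1 + 1 = a + b)%N by lia.
  by ring.
Qed.

(** * Summation of a decomposition step *)

Lemma posvec_vperm_bij (N : nat) (pi : 'S_N) :
  set_bij (@posvec N) (@posvec N) (vperm pi).
Proof.
split=> [l l0 k|l l' _ _ ll'|l l0]; first by rewrite ffunE.
  apply/ffunP => k; have /ffunP/(_ (pi^-1%g k)) := ll'.
  by rewrite !ffunE permKV.
exists (vperm pi^-1 l); first by move=> k; rewrite ffunE.
by apply/ffunP => k; rewrite !ffunE permK.
Qed.

Lemma esum_natZ (R : realType) (T : choiceType) (D : set T) (n : nat)
    (f : T -> R) : (forall x, D x -> 0 <= f x) ->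
  (\esum_(x in D) (n%:R * f x)%:E = n%:R%:E * \esum_(x in D) (f x)%:E)%E.
Proof.
move=> f0; elim: n => [|n IHn].
  by rewrite mul0e esum1 // => x _; rewrite mul0r.
rewrite -addn1 natrD EFinD ge0_muleDl ?lee_fin // mul1e -IHn.
rewrite -esumD => [|x Dx|x Dx]; rewrite ?lee_fin ?mulr_ge0 ?f0 //.
by apply: eq_esum => x _; rewrite -EFinD mulrDl mul1r.
Qed.

Lemma zetaA_cvgE (R : realType) (N : nat) (s : nat -> nat -> nat) :
  zetaA_cvg R N s <-> (\esum_(l in @posvec N) (zterm R s l)%:E < +oo)%E.
Proof.
rewrite /zetaA_cvg /summable; under eq_esum do rewrite gee0_abs ?lee_fin ?zterm_ge0 //.
by [].
Qed.

Lemma zetaA_fin (R : realType) (N : nat) (s : nat -> nat -> nat) :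
  zetaA_cvg R N s ->
  (\esum_(l in @posvec N) (zterm R s l)%:E = (zetaA R N s)%:E)%E.
Proof.
move=> /zetaA_cvgE s_cvg; rewrite /zetaA fineK // ge0_fin_numE // esum_ge0 // => l _.
by rewrite lee_fin zterm_ge0.
Qed.

(** Summation of the termwise identity, in the extended reals so that no
    convergence is needed. *)
Lemma esum_pfd_step (R : realType) (N : nat) (u v : nat * nat)
    (s : nat -> nat -> nat) (s1 s2 : nat -> nat -> nat -> nat) :
  pfd_step R N u v s s1 s2 ->
  let alpha := s u.1 u.2 in let beta := s v.1 v.2 in
  let S s := (\esum_(l in @posvec N) (zterm R s l)%:E)%E in
  (S s = \sum_(tau < beta) 'C(alpha - 1 + tau, tau)%:R%:E * S (s1 tau)
       + \sum_(tau < alpha) 'C(beta - 1 + tau, tau)%:R%:E * S (s2 tau))%E.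
Proof.
case=> _ _ split_s step1 step2 alpha beta S.
pose X l := linform R (N := N) l u; pose Y l := linform R (N := N) l v.
pose A1 tau l := zrest R s u v l * ((X l + Y l) ^- (alpha + tau) * Y l ^- (beta - tau)).
pose A2 tau l := zrest R s u v l * ((X l + Y l) ^- (beta + tau) * X l ^- (alpha - tau)).
have A1_ge0 (tau : 'I_beta) l : posvec l -> 0 <= A1 tau l.
  by move=> l0; have [pi piE] := step1 tau (ltn_ord tau); rewrite /A1 piE ?zterm_ge0.
have A2_ge0 (tau : 'I_alpha) l : posvec l -> 0 <= A2 tau l.
  by move=> l0; have [pi piE] := step2 tau (ltn_ord tau); rewrite /A2 piE ?zterm_ge0.
have S1 (tau : 'I_beta) : S (s1 tau) = (\esum_(l in @posvec N) (A1 tau l)%:E)%E.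
  have [pi piE] := step1 tau (ltn_ord tau).
  rewrite /S (@reindex_esum _ _ _ _ _ _ _ (posvec_vperm_bij pi)).
  by apply: eq_esum => l l0; rewrite -piE.
have S2 (tau : 'I_alpha) : S (s2 tau) = (\esum_(l in @posvec N) (A2 tau l)%:E)%E.
  have [pi piE] := step2 tau (ltn_ord tau).
  rewrite /S (@reindex_esum _ _ _ _ _ _ _ (posvec_vperm_bij pi)).
  by apply: eq_esum => l l0; rewrite -piE.
transitivity (\esum_(l in @posvec N)
   (\sum_(tau < beta) ('C(alpha - 1 + tau, tau)%:R * A1 tau l)%:E
    + \sum_(tau < alpha) ('C(beta - 1 + tau, tau)%:R * A2 tau l)%:E))%E.
  apply: eq_esum => l l0; have [-> ->] := split_s l l0.
  rewrite !sumEFin -EFinD /pfd_rhs mulrDr !mulr_sumr; congr (_ + _)%:E;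
    by apply: eq_bigr => tau _; rewrite mulrCA.
rewrite esumD; [| |].
- congr (_ + _)%E; rewrite esum_sum => [|l tau l0 _].
  + by apply: eq_bigr => tau _; rewrite S1 esum_natZ // => l; apply: A1_ge0.
  + by rewrite lee_fin mulr_ge0 // A1_ge0.
  + by apply: eq_bigr => tau _; rewrite S2 esum_natZ // => l; apply: A2_ge0.
  + by rewrite lee_fin mulr_ge0 // A2_ge0.
- by move=> l l0; apply: sume_ge0 => tau _; rewrite lee_fin mulr_ge0 // A1_ge0.
- by move=> l l0; apply: sume_ge0 => tau _; rewrite lee_fin mulr_ge0 // A2_ge0.
Qed.

(** The coefficients are binomials that are at least 1, so each resulting
    series is bounded by the given one. *)
Lemma pfd_step_zetaA (R : realType) (N : nat) (u v : nat * nat)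
    (s : nat -> nat -> nat) (s1 s2 : nat -> nat -> nat -> nat) :
  pfd_step R N u v s s1 s2 -> zetaA_cvg R N s ->
  let alpha := s u.1 u.2 in let beta := s v.1 v.2 in
  [/\ forall tau, (tau < beta)%N -> zetaA_cvg R N (s1 tau),
      forall tau, (tau < alpha)%N -> zetaA_cvg R N (s2 tau) &
      zetaA R N s
      = \sum_(tau < beta) 'C(alpha - 1 + tau, tau)%:R * zetaA R N (s1 tau)
      + \sum_(tau < alpha) 'C(beta - 1 + tau, tau)%:R * zetaA R N (s2 tau)].
Proof.
move=> /esum_pfd_step /= sE s_cvg.
pose S s := (\esum_(l in @posvec N) (zterm R s l)%:E)%E.
have S_ge0 s' : (0 <= S s')%E by apply: esum_ge0 => l _; rewrite lee_fin zterm_ge0.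
have CS_ge0 n k s' : (0 <= 'C(n, k)%:R%:E * S s')%E by rewrite mule_ge0 ?lee_fin.
have le_CS n k s' : (S s' <= 'C(n + k, k)%:R%:E * S s')%E.
  by rewrite -[leLHS]mul1e lee_wpmul2r // lee_fin ler1n bin_gt0 leq_addl.
have s_lt : (S s < +oo)%E := proj1 (zetaA_cvgE R N s) s_cvg.
have cvg1 tau : (tau < s v.1 v.2)%N -> zetaA_cvg R N (s1 tau).
  move=> lt_tau; apply/zetaA_cvgE; apply: le_lt_trans s_lt.
  apply: (le_trans (le_CS (s u.1 u.2 - 1)%N tau (s1 tau))).
  rewrite /S sE (bigD1 (Ordinal lt_tau)) //= -addeA leeDl // adde_ge0 //
    sume_ge0 // => k _; exact: CS_ge0.
have cvg2 tau : (tau < s u.1 u.2)%N -> zetaA_cvg R N (s2 tau).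
  move=> lt_tau; apply/zetaA_cvgE; apply: le_lt_trans s_lt.
  apply: (le_trans (le_CS (s v.1 v.2 - 1)%N tau (s2 tau))).
  rewrite /S sE addeC (bigD1 (Ordinal lt_tau)) //= -addeA leeDl // adde_ge0 //
    sume_ge0 // => k _; exact: CS_ge0.
split; [exact: cvg1 | exact: cvg2 | apply: EFin_inj].
rewrite -(zetaA_fin s_cvg) sE EFinD -!sumEFin.
congr (_ + _)%E; apply: eq_bigr => tau _.
  by rewrite EFinM (zetaA_fin (cvg1 _ (ltn_ord tau))).
by rewrite EFinM (zetaA_fin (cvg2 _ (ltn_ord tau))).
Qed.

(** * Multiple zeta values as series with a single chain *)

(** The partial sum l_1 + ... + l_n, as a natural number. *)
Definition lsum (N : nat) (l : {ffun 'I_N -> nat}) (n : nat) : nat :=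
  (\sum_(k < N | k < n) l k)%N.

Lemma lsum0 (N : nat) (l : {ffun 'I_N -> nat}) : lsum l 0 = 0%N.
Proof. by rewrite /lsum big_pred0. Qed.

Lemma lsumS (N : nat) (l : {ffun 'I_N -> nat}) (n : nat) (nN : (n < N)%N) :
  lsum l n.+1 = (lsum l n + l (Ordinal nN))%N.
Proof.
rewrite /lsum (bigD1 (Ordinal nN)) //= addnC; congr (_ + _)%N.
by apply: eq_bigl => k; rewrite -val_eqE /=; lia.
Qed.

Lemma psum_lsum (R : realType) (N : nat) (l : {ffun 'I_N -> nat}) (n : nat) :
  psum R l 0 n = (lsum l n)%:R.
Proof. by rewrite /lsum natr_sum. Qed.

Lemma lsum_lt (N : nat) (l : {ffun 'I_N -> nat}) (m n : nat) :
  posvec l -> (m < n)%N -> (n <= N)%N -> (lsum l m < lsum l n)%N.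
Proof.
move=> l0; elim: n => // n IHn; rewrite ltnS leq_eqVlt => m_n nN.
rewrite (lsumS l nN); have := l0 (Ordinal nN).
by case/orP: m_n => [/eqP->|/IHn/(_ (ltnW nN))]; lia.
Qed.

Lemma lsum_inj (N : nat) (l l' : {ffun 'I_N -> nat}) :
  (forall n, (n <= N)%N -> lsum l n = lsum l' n) -> l = l'.
Proof.
move=> ll'; apply/ffunP => -[k kN].
have := ll' k.+1 kN; rewrite !(lsumS _ kN) (ll' k (ltnW kN)).
exact: addnI.
Qed.

(** The range of summation m_1 > ... > m_N > 0 of a multiple zeta
    value. *)
Definition decreasing_tuples (N : nat) : set (N.-tuple nat) :=
  [set m : N.-tuple nat | (forall i, (0 < tnth m i)%N) /\
     (forall i j : 'I_N, (i < j)%N -> (tnth m j < tnth m i)%N)].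

Lemma partial_sums_bij (N : nat) :
  set_bij (@posvec N) (@decreasing_tuples N)
    (fun l => [tuple lsum l (N - i) | i < N]).
Proof.
split.
- move=> l l0; split=> [i|i j ij]; rewrite !tnth_mktuple.
    by rewrite -(lsum0 l) lsum_lt //; have := ltn_ord i; lia.
  by apply: lsum_lt => //; have := ltn_ord j; lia.
- move=> l l' _ _ ll'; apply: lsum_inj => n nN.
  case: n nN => [|n] nN; first by rewrite !lsum0.
  have iN : (N - n.+1 < N)%N by lia.
  have := congr1 (fun m => tnth m (Ordinal iN)) ll'; rewrite !tnth_mktuple /=.
  by rewrite subKn.
move=> m [m0 m_decr].
(* g n is the value that the n-th partial sum has to take; the default 0 of
   [nth] gives the empty sum g 0. *)
pose g n := nth 0%N m (N - n).
have gE n (nN : (N - n < N)%N) : g n = tnth m (Ordinal nN).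
  by rewrite (tnth_nth 0%N).
have g0 : g 0%N = 0%N by rewrite /g subn0 nth_default ?size_tuple.
have g_lt n : (n < N)%N -> (g n < g n.+1)%N.
  move=> nN; have nN1 : (N - n.+1 < N)%N by lia.
  rewrite (gE n.+1 nN1); case: n nN nN1 => [|n] nN nN1; first by rewrite g0 m0.
  have nN2 : (N - n.+1 < N)%N by lia.
  by rewrite (gE n.+1 nN2) m_decr //=; lia.
pose l : {ffun 'I_N -> nat} := [ffun k : 'I_N => (g k.+1 - g k)%N].
have lE n : (n <= N)%N -> lsum l n = g n.
  elim: n => [|n IHn] nN; first by rewrite lsum0 g0.
  by rewrite (lsumS l nN) IHn ?(ltnW nN) // ffunE subnKC // ltnW // g_lt.
exists l; first by move=> k; rewrite ffunE subn_gt0 g_lt.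
apply: eq_from_tnth => i; rewrite tnth_mktuple lE ?leq_subr //.
have iN := ltn_ord i; have iN' : (N - (N - i) < N)%N by lia.
by rewrite (gE _ iN'); congr (tnth m _); apply: val_inj => /=; lia.
Qed.

Lemma mzv_posvec (R : realType) (ks : seq nat) (N : nat) : size ks = N ->
  mzv R ks = fine (\esum_(l in @posvec N)
    (\prod_(i < N) psum R l 0 (N - i) ^- nth 0%N ks i)%:E).
Proof.
move=> <-; rewrite /mzv (@reindex_esum _ _ _ _ _ _ _ (partial_sums_bij (size ks))).
congr fine; apply: eq_esum => l _; congr EFin; apply: eq_bigr => i _.
by rewrite tnth_mktuple psum_lsum.
Qed.

Lemma mzv_zexps (R : realType) (N : nat) (e : nat -> nat) :
  mzv R (zexps N e) = fine (\esum_(l in @posvec N)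
    (\prod_(i < N) psum R l 0 i.+1 ^- e i.+1)%:E).
Proof.
rewrite (@mzv_posvec _ _ N); last by rewrite size_map size_iota.
congr fine; apply: eq_esum => l _; congr EFin.
rewrite [RHS](reindex_inj rev_ord_inj); apply: eq_bigr => i _ /=.
have lt_i := ltn_ord i; rewrite (nth_map 0%N) ?size_iota // nth_iota // add0n.
by congr (psum R l 0 _ ^- e _); lia.
Qed.

Lemma Z_zword (R : realType) (N : nat) (e : nat -> nat) :
  (forall i, (1 <= i <= N)%N -> (0 < e i)%N) ->
  Z R (zword N e) = fine (\esum_(l in @posvec N)
    (\prod_(i < N) psum R l 0 i.+1 ^- e i.+1)%:E).
Proof.
move=> e0; rewrite zword_prod Z_zprod ?mzv_zexps //.
by apply/allP => k /mapP[i]; rewrite mem_iota => iN ->; apply: e0; lia.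
Qed.

Lemma sh_gword_1 (u : seq bool) : sh (gword u) 1 = gword u.
Proof. by rewrite -[X in sh _ X]gword1 sh_gword shw0r. Qed.

Lemma sh_1_gword (u : seq bool) : sh 1 (gword u) = gword u.
Proof. by rewrite -[X in sh X _]gword1 sh_gword. Qed.

Lemma spp_word_b0 (a c : nat) (p q r : nat -> nat) :
  spp_word a 0 c p q r
  = zword (c + a) (fun i => if (i <= a)%N then p i else r (i - a)%N).
Proof.
rewrite /spp_word zword0 (zwordE a p) sh_gword_1 -(zwordE a p).
exact: zwordD.
Qed.

Lemma spp_word_a0 (b c : nat) (p q r : nat -> nat) :
  spp_word 0 b c p q r
  = zword (c + b) (fun i => if (i <= b)%N then q i else r (i - b)%N).
Proof.
rewrite /spp_word zword0 (zwordE b q) sh_1_gword -(zwordE b q).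
exact: zwordD.
Qed.

Lemma Z_chain (R : realType) (N m c : nat) (p r : nat -> nat) :
  N = (m + c)%N ->
  (forall i, (1 <= i <= m)%N -> (0 < p i)%N) ->
  (forall i, (1 <= i <= c)%N -> (0 < r i)%N) ->
  Z R (zword (c + m) (fun i => if (i <= m)%N then p i else r (i - m)%N))
  = fine (\esum_(l in @posvec N)
      (\prod_(k < m) psum R l 0 k.+1 ^- p k.+1
       * \prod_(k < c) psum R l 0 (m + k.+1) ^- r k.+1)%:E).
Proof.
move=> -> p0 r0; rewrite addnC Z_zword => [|i ic]; last first.
  by case: ifP => im; [apply: p0 | apply: r0]; lia.
congr fine; apply: eq_esum => l _; congr EFin.
rewrite big_split_ord /=; congr (_ * _); apply: eq_bigr => k _.
  by rewrite ltn_ord.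
by rewrite ifF; [congr (psum R l 0 _ ^- r _) |]; lia.
Qed.

(** The base of the induction: one of the two shuffled words is empty. *)
Lemma Z_spp_word_degenerate (R : realType) (N a b c : nat) (p q r : nat -> nat) :
  N = (a + b + c)%N -> a = 0%N \/ b = 0%N ->
  (forall i, (1 <= i <= a)%N -> (0 < p i)%N) ->
  (forall i, (1 <= i <= b)%N -> (0 < q i)%N) ->
  (forall i, (1 <= i <= c)%N -> (0 < r i)%N) ->
  Z R (spp_word a b c p q r) = zetaA R N (dA a b c p q r).
Proof.
move=> defN [a0|b0] p0 q0 r0; subst.
  rewrite spp_word_a0 (@Z_chain R (0 + b + c)) //.
  congr fine; apply: eq_esum => l _; congr EFin.
  rewrite (@zterm_dA _ _ 0 b c) //; congr (_ * _); rewrite -[LHS]mul1r.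
  congr (_ * _). by rewrite big_ord0.
rewrite spp_word_b0 (@Z_chain R (a + 0 + c)) //; last by rewrite addn0.
congr fine; apply: eq_esum => l _; congr EFin.
rewrite (@zterm_dA _ _ a 0 c) //.
congr (_ * _); last first.
  by apply: eq_bigr => k _; congr (psum R l 0 _ ^- _); rewrite addn0.
by rewrite -[LHS]mulr1; congr (_ * _); rewrite big_ord0.
Qed.

(** * A divergence criterion *)

(** A series with nonnegative terms diverges if some injective sequence of
    its terms its terms has the form C / (B + n) with C, B > 0. *)
Lemma esum_harmonic_dvg (R : realType) (T : choiceType) (D : set T)
    (f : T -> R) (e : nat -> T) (C B : R) :
  injective e -> (forall n, D (e n)) -> (forall x, D x -> 0 <= f x) ->
  0 < C -> 0 < B -> (forall n, f (e n) = C / (B + n%:R)) ->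
  ~ (\esum_(x in D) (f x)%:E < +oo)%E.
Proof.
move=> e_inj De f0 C0 B0 fe D_cvg; apply: (@dvg_harmonic R).
pose K := C / (1 + B).
have K0 : 0 < K by rewrite divr_gt0 // addr_gt0.
have le_f n : harmonic n <= K^-1 * f (e n).
  rewrite fe /K /= invf_div mulrA mulfVK ?gt_eqF //.
  have Bn : 0 < B + n%:R by rewrite ltr_wpDr.
  rewrite ler_pdivlMr // mulrC ler_pdivrMr // -natr1.
  by have : 0 <= B * n%:R; [rewrite mulr_ge0 // ltW | lra].
have fe_cvg : (\esum_(n in [set: nat]) (f (e n))%:E < +oo)%E.
  apply: le_lt_trans D_cvg; rewrite -(@esum_image _ _ _ _ e (fun x => (f x)%:E)).
    rewrite (@esumID _ _ (range e) D) => [|x Dx]; last by rewrite lee_fin f0.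
    rewrite setIC (setIidl (_ : range e `<=` D)) => [|x [n _ <-] //].
    by rewrite leeDl // esum_ge0 // => x [Dx _]; rewrite lee_fin f0.
  by move=> m n _ _; apply: e_inj.
(* An integer multiple, since [esum_natZ] scales sums by integers only. *)
pose M := Num.bound K^-1.
have le_Mf n : harmonic n <= M%:R * f (e n).
  apply: le_trans (le_f n) _; rewrite ler_wpM2r ?f0 //.
  by rewrite ltW // archi_boundP // invr_ge0 ltW.
have h_sum : summable xpredT (EFin \o (@harmonic R)).
  rewrite /summable; apply: (@le_lt_trans _ _
    (\esum_(n in [set: nat]) (M%:R * f (e n))%:E)%E).
    rewrite (_ : (fun x => is_true (xpredT x)) = [set: nat]); last first.
      by apply/seteqP; split.
    by apply: le_esum => n _; rewrite /= lee_fin ger0_norm ?le_Mf ?invr_ge0.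
  rewrite esum_natZ => [|n _]; last exact: f0.
  by rewrite lte_mul_pinfty ?lee_fin.
have h0 i : xpredT i -> (0 <= (EFin \o (@harmonic R)) i)%E.
  by move=> _; rewrite lee_fin harmonic_ge0.
exact: summable_cvg h0 h_sum.
Qed.

(** The summation index that is 1 everywhere except at [k0], where it is
    n + 1. *)
Definition bumped (N : nat) (k0 : 'I_N) (n : nat) : {ffun 'I_N -> nat} :=
  [ffun k => if k == k0 then n.+1 else 1%N].

Lemma bumped_inj (N : nat) (k0 : 'I_N) : injective (bumped k0).
Proof.
by move=> m n /ffunP/(_ k0); rewrite !ffunE eqxx => -[].
Qed.

Lemma posvec_bumped (N : nat) (k0 : 'I_N) (n : nat) : posvec (bumped k0 n).
Proof. by move=> k; rewrite ffunE; case: ifP. Qed.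

Lemma psum_bumped (R : realType) (N : nat) (k0 : 'I_N) (i m n : nat) :
  psum R (bumped k0 n) i m
  = psum R (bumped k0 0) i m + (if (i <= k0 < i + m)%N then n%:R else 0).
Proof.
have bumpedE k : bumped k0 n k = (bumped k0 0 k + (if k == k0 then n else 0))%N.
  by rewrite !ffunE; case: ifP; rewrite ?add1n ?addn0.
rewrite /psum; under eq_bigr do rewrite bumpedE natrD.
rewrite big_split /=; congr (_ + _); case: ifP => k0_in.
  by rewrite (bigD1 k0) //= eqxx big1 ?addr0 // => k /andP[_ /negPf ->].
rewrite big1 // => k k_in; case: eqP => // kk0.
by rewrite -kk0 k_in in k0_in.
Qed.

Lemma zterm_gt0 (R : realType) (N : nat) (s : nat -> nat -> nat)
  (l : {ffun 'I_N -> nat}) : posvec l -> 0 < zterm R s l.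
Proof.
move=> l0; rewrite /zterm big_seq_cond; apply: prodr_gt0 => i.
rewrite mem_index_iota andbT => i_in; rewrite big_seq_cond.
apply: prodr_gt0 => j; rewrite mem_index_iota andbT => j_in.
have i1N : (i.-1 < N)%N by lia.
rewrite invr_gt0 exprn_gt0 // /linform (bigD1 (Ordinal i1N)) /=; last by lia.
by apply: ltr_pwDl; rewrite ?ltr0n ?l0 // sumr_ge0.
Qed.

(** The hypothesis says that, along the direction of the variable [k0], the
    summand is a constant over B + n. *)
Lemma zetaA_dvg (R : realType) (N : nat) (s : nat -> nat -> nat)
    (k0 : 'I_N) (B : R) : 0 < B ->
  (forall n, zterm R s (bumped k0 n)
    = zterm R s (bumped k0 0) * (B / (B + n%:R))) ->
  ~ zetaA_cvg R N s.
Proof.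
move=> B0 bumpE /zetaA_cvgE.
apply: (@esum_harmonic_dvg _ _ _ _ (bumped k0) (zterm R s (bumped k0 0) * B) B).
- exact: bumped_inj.
- exact: posvec_bumped.
- by move=> l _; apply: zterm_ge0.
- by rewrite mulr_gt0 // zterm_gt0 //; apply: posvec_bumped.
- by [].
- by move=> n; rewrite bumpE mulrA.
Qed.

(** * Leading exponents of a convergent series *)

Lemma prod_psum_bumped (R : realType) (N m : nat) (k0 : 'I_N) (i w : nat -> nat)
    (e : nat -> nat) (n : nat) :
  (forall k, (k < m)%N -> (i k <= k0 < i k + w k)%N = false) ->
  \prod_(k < m) psum R (bumped k0 n) (i k) (w k) ^- e k
  = \prod_(k < m) psum R (bumped k0 0) (i k) (w k) ^- e k.
Proof.
move=> out; apply: eq_bigr => k _.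
by rewrite psum_bumped out ?addr0 // ltn_ord.
Qed.

(** The last variable occurs in the sum with exponent r_c only. *)
Lemma zetaA_cvg_dA_r (R : realType) (N a b c : nat) (p q r : nat -> nat) :
  N = (a + b + c)%N -> (0 < c)%N -> zetaA_cvg R N (dA a b c p q r) -> r c <> 1%N.
Proof.
move=> defN c0 s_cvg rc1.
have kN : (N.-1 < N)%N by lia.
pose k0 := Ordinal kN; pose S := psum R (bumped k0 0) 0 N.
have S0 : 0 < S by apply: psum_gt0; [exact: posvec_bumped | lia | lia].
apply: (@zetaA_dvg R N (dA a b c p q r) k0 S) => // n.
have Sn : S + n%:R != 0 by rewrite gt_eqF // ltr_wpDr.
have S_neq0 : S != 0 by rewrite gt_eqF.
rewrite !(zterm_dA _ _ _ _ _ defN).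
rewrite (@prod_psum_bumped R N a k0 (fun=> 0%N) (fun k => k.+1)
  (fun k => p k.+1)) => [|k ka]; last by rewrite /=; lia.
rewrite (@prod_psum_bumped R N b k0 (fun=> a) (fun k => k.+1)
  (fun k => q k.+1)) => [|k kb]; last by rewrite /=; lia.
case: c => // c in defN c0 s_cvg rc1 *; rewrite !big_ord_recr /= rc1 !expr1.
rewrite (@prod_psum_bumped R N c k0 (fun=> 0%N) (fun k => (a + b + k.+1)%N)
  (fun k => r k.+1)) => [|k kc]; last by rewrite /=; lia.
rewrite psum_bumped ifT; last by rewrite /=; lia.
rewrite -defN -/S; by field; rewrite Sn.
Qed.

(** If c = 0, the variable l_a occurs in the sum with exponent p_a only. *)
Lemma zetaA_cvg_dA_p (R : realType) (N a b : nat) (p q r : nat -> nat) :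
  N = (a + b + 0)%N -> (0 < a)%N -> zetaA_cvg R N (dA a b 0 p q r) -> p a <> 1%N.
Proof.
move=> defN a0 s_cvg pa1.
have kN : (a.-1 < N)%N by lia.
pose k0 := Ordinal kN; pose S := psum R (bumped k0 0) 0 a.
have S0 : 0 < S by apply: psum_gt0; [exact: posvec_bumped | lia | lia].
apply: (@zetaA_dvg R N (dA a b 0 p q r) k0 S) => // n.
have Sn : S + n%:R != 0 by rewrite gt_eqF // ltr_wpDr.
have S_neq0 : S != 0 by rewrite gt_eqF.
rewrite !(zterm_dA _ _ _ _ _ defN) !big_ord0.
rewrite (@prod_psum_bumped R N b k0 (fun=> a) (fun k => k.+1)
  (fun k => q k.+1)) => [|k kb]; last by rewrite /=; lia.
case: a => // a in defN a0 s_cvg pa1 kN k0 S S0 Sn S_neq0 *.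
rewrite !big_ord_recr /= pa1 !expr1.
rewrite (@prod_psum_bumped R N a k0 (fun=> 0%N) (fun k => k.+1)
  (fun k => p k.+1)) => [|k ka]; last by rewrite /=; lia.
rewrite psum_bumped ifT; last by rewrite /=; lia.
rewrite -/S; by field; rewrite Sn.
Qed.

(** If c = 0, the variable l_(a+b) occurs in the sum with exponent q_b only. *)
Lemma zetaA_cvg_dA_q (R : realType) (N a b : nat) (p q r : nat -> nat) :
  N = (a + b + 0)%N -> (0 < b)%N -> zetaA_cvg R N (dA a b 0 p q r) -> q b <> 1%N.
Proof.
move=> defN b0 s_cvg qb1.
have kN : ((a + b).-1 < N)%N by lia.
pose k0 := Ordinal kN; pose S := psum R (bumped k0 0) a b.
have S0 : 0 < S by apply: psum_gt0; [exact: posvec_bumped | lia | lia].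
apply: (@zetaA_dvg R N (dA a b 0 p q r) k0 S) => // n.
have Sn : S + n%:R != 0 by rewrite gt_eqF // ltr_wpDr.
have S_neq0 : S != 0 by rewrite gt_eqF.
rewrite !(zterm_dA _ _ _ _ _ defN) !big_ord0.
rewrite (@prod_psum_bumped R N a k0 (fun=> 0%N) (fun k => k.+1)
  (fun k => p k.+1)) => [|k kb]; last by rewrite /=; lia.
case: b => // b in defN b0 s_cvg qb1 kN k0 S S0 Sn S_neq0 *.
rewrite !big_ord_recr /= qb1 !expr1.
rewrite (@prod_psum_bumped R N b k0 (fun=> a) (fun k => k.+1)
  (fun k => q k.+1)) => [|k ka]; last by rewrite /=; lia.
rewrite psum_bumped ifT; last by rewrite /=; lia.
rewrite -/S; by field; rewrite Sn.
Qed.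

(** * Membership in H^0 and the evaluation *)

(** A shuffle product is a sum of words, each ending in y when both factors
    do and starting with y only if one of the factors does.  The default values
    treat an empty word as ending in y and not starting with y, which is the
    behaviour of 1 in H^0; the length is recorded to know that a word is
    nonempty. *)
Lemma shw_words (u v : seq bool) : last true u -> last true v ->
  exists2 ws : seq (seq bool), shw u v = \sum_(w <- ws) gword w &
    all (fun w => [&& size w == (size u + size v)%N, last true w &
                      head false w ==> head false u || head false v]) ws.
Proof.
elim: u v => [|s u IHu] v.
  move=> _ v1; exists [:: v]; first by rewrite big_seq1.
  by rewrite /= eqxx v1 implybb.
elim: v => [|t v IHv] su1 tv1.
  exists [:: s :: u]; first by rewrite big_seq1 shw0r.
  by rewrite /= addn0 eqxx orbF implybb; move: su1 => /= ->.
have u1 : last true u by case: u su1 {IHu IHv}.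
have v1 : last true v by case: v tv1 {IHv}.
have [ws1 ws1E ws1P] := IHu (t :: v) u1 tv1.
have [ws2 ws2E ws2P] := IHv su1 v1.
exists ([seq s :: w | w <- ws1] ++ [seq t :: w | w <- ws2]).
  rewrite shw_cons ws1E ws2E big_cat !big_map /= !mulr_sumr.
  by congr (_ + _); apply: eq_bigr => w _; rewrite -gwordM.
rewrite all_cat !all_map; apply/andP; split.
  apply: sub_all ws1P => w /and3P[/eqP szw w1 _] /=.
  rewrite szw /= addSn eqxx /=; apply/andP; split; last by case: (s).
  by case: w w1 szw => //= _; rewrite addnS.
apply: sub_all ws2P => w /and3P[/eqP szw w1 _] /=.
rewrite szw /= !addSn addnS eqxx /=; apply/andP; split.
  by case: w w1 szw.
by case: (t); rewrite ?orbT.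
Qed.

Lemma sandwichD (K : pzRingType) (A : lalgType K) (x y g g' : A) (k k' : K) :
  (k%:A + x * g * y) + (k'%:A + x * g' * y) = (k + k')%:A + x * (g + g') * y.
Proof. by rewrite addrACA scalerDl mulrDr mulrDl. Qed.

Lemma H0D (f f' : Hxy) : H0 f -> H0 f' -> H0 (f + f').
Proof.
move=> [k [g ->]] [k' [g' ->]]; exists (k + k'), (g + g').
exact: sandwichD.
Qed.

Lemma sandwich0 (K : pzRingType) (A : lalgType K) (x y : A) :
  0 = (0 : K)%:A + x * 0 * y.
Proof. by rewrite scale0r mulr0 mul0r addr0. Qed.

Lemma H0_0 : H0 0.
Proof. by exists 0, 0; exact: sandwich0. Qed.

Lemma sandwich1 (K : pzRingType) (A : lalgType K) (x y : A) :
  1 = (1 : K)%:A + x * 0 * y.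
Proof. by rewrite scale1r mulr0 mul0r addr0. Qed.

Lemma sandwich_in (K : pzRingType) (A : lalgType K) (x g y : A) :
  x * g * y = (0 : K)%:A + x * g * y.
Proof. by rewrite scale0r add0r. Qed.

Lemma H0_gword (w : seq bool) : ~~ head false w -> last true w -> H0 (gword w).
Proof.
case: w => [|[] w] //=.
  by move=> _ _; rewrite gword1; exists 1, 0; exact: sandwich1.
case/lastP: w => [//|w t] _; rewrite last_rcons => t1.
rewrite -cats1 -cat1s !gwordM t1; exists 0, (gword w).
rewrite mulrA; exact: sandwich_in.
Qed.

Lemma last_zletters (ks : seq nat) : last true (zletters ks).
Proof. by elim: ks => // k ks IHks; rewrite zletters_cons last_cat. Qed.

Lemma head_zletters (n : nat) (e : nat -> nat) :
  ((0 < n)%N -> (1 < e n)%N) -> ~~ head false (zletters (zexps n e)).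
Proof.
case: n => // n /(_ isT) e1; rewrite zexpsS zletters_cons.
by case: (e n.+1) e1 => [|[]].
Qed.

(** The leading exponents are at least 2, so all nonempty words start with x. *)
Lemma H0_spp_word (a b c : nat) (p q r : nat -> nat) :
  ((0 < c)%N -> (1 < r c)%N) ->
  (c = 0%N -> (0 < a)%N -> (1 < p a)%N) ->
  (c = 0%N -> (0 < b)%N -> (1 < q b)%N) ->
  H0 (spp_word a b c p q r).
Proof.
move=> r1 p1 q1; rewrite spp_wordE (zwordE c r).
set P := zletters (zexps c r).
have [ws -> wsP] := shw_words (last_zletters (zexps a p)) (last_zletters (zexps b q)).
rewrite mulr_sumr big_seq; elim/big_ind: _ => [||w w_in].
- exact: H0_0.
- exact: H0D.
rewrite -gwordM; have /and3P[_ w1 w0] := allP wsP w w_in.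
have Pr : ~~ head false P by apply: head_zletters.
apply: H0_gword; last first.
  rewrite last_cat; case: w w1 {w_in w0} => // _.
  exact: last_zletters.
case: c => [|c] in r1 p1 q1 P Pr *.
  apply/negP => /(implyP w0); apply/negP; rewrite negb_or.
  by rewrite !head_zletters //; auto.
by move: Pr; rewrite /P zexpsS zletters_cons; case: (r c.+1).-1.
Qed.

Lemma H0_of_cvg (R : realType) (N a b c : nat) (p q r : nat -> nat) :
  N = (a + b + c)%N ->
  (forall i, (1 <= i <= a)%N -> (0 < p i)%N) ->
  (forall i, (1 <= i <= b)%N -> (0 < q i)%N) ->
  (forall i, (1 <= i <= c)%N -> (0 < r i)%N) ->
  zetaA_cvg R N (dA a b c p q r) -> H0 (spp_word a b c p q r).
Proof.
move=> defN p0 q0 r0 s_cvg; apply: H0_spp_word => [c0|c0 a0|c0 b0]; subst.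
- have := zetaA_cvg_dA_r erefl c0 s_cvg; have := r0 c; lia.
- have := zetaA_cvg_dA_p erefl a0 s_cvg; have := p0 a; lia.
- have := zetaA_cvg_dA_q erefl b0 s_cvg; have := q0 b; lia.
Qed.

Lemma ZD (R : realType) (f g : Hxy) : Z R (f + g) = Z R f + Z R g.
Proof. by have := Z_linear R 1 f g; rewrite scale1r rmorph1 mul1r. Qed.

Lemma Z0 (R : realType) : Z R 0 = 0.
Proof. exact: mmap0. Qed.

Lemma ZnatZ (R : realType) (n : nat) (f : Hxy) : Z R (n%:R *: f) = n%:R * Z R f.
Proof. by have := Z_linear R n%:R f 0; rewrite addr0 Z0 addr0 ratr_nat. Qed.

Lemma Z_sum (R : realType) (I : Type) (s : seq I) (f : I -> Hxy) :
  Z R (\sum_(i <- s) f i) = \sum_(i <- s) Z R (f i).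
Proof. exact: (big_morph (Z R) (ZD R) (Z0 R)). Qed.

Lemma set_at_pos (n v : nat) (q : nat -> nat) : (0 < v)%N ->
  (forall i, (1 <= i <= n)%N -> (0 < q i)%N) ->
  forall i, (1 <= i <= n)%N -> (0 < set_at n v q i)%N.
Proof. by move=> v0 q0 i i_in; rewrite /set_at; case: eqP => // _; apply: q0. Qed.

Lemma ins_first_pos (c v : nat) (r : nat -> nat) : (0 < v)%N ->
  (forall i, (1 <= i <= c)%N -> (0 < r i)%N) ->
  forall i, (1 <= i <= c.+1)%N -> (0 < ins_first v r i)%N.
Proof.
by move=> v0 r0 i i_in; rewrite /ins_first; case: eqP => // i1; apply: r0; lia.
Qed.

Lemma pfd_zetaA_dA (R : realType) (N a b c : nat) (p q r : nat -> nat) :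
  N = (a + b + c)%N -> (0 < a)%N -> (0 < b)%N -> (0 < p a)%N -> (0 < q b)%N ->
  zetaA_cvg R N (dA a b c p q r) ->
  [/\ forall tau, (tau < q b)%N -> zetaA_cvg R N (dA_left a b c p q r tau),
      forall tau, (tau < p a)%N -> zetaA_cvg R N (dA_right a b c p q r tau) &
      zetaA R N (dA a b c p q r)
      = \sum_(tau < q b) 'C(p a - 1 + tau, tau)%:R
          * zetaA R N (dA_left a b c p q r tau)
      + \sum_(tau < p a) 'C(q b - 1 + tau, tau)%:R
          * zetaA R N (dA_right a b c p q r tau)].
Proof.
move=> defN a0 b0 pa qb s_cvg.
have := pfd_step_zetaA (pfd_step_dA R r defN a0 b0 pa qb) s_cvg.
by rewrite /= dA_at_p // dA_at_q.
Qed.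

(** Induction on a + b: both sides satisfy the recursion given by one step
    of the procedure. *)
Lemma Z_spp_word (R : realType) (N a b c : nat) (p q r : nat -> nat) :
  N = (a + b + c)%N ->
  (forall i, (1 <= i <= a)%N -> (0 < p i)%N) ->
  (forall i, (1 <= i <= b)%N -> (0 < q i)%N) ->
  (forall i, (1 <= i <= c)%N -> (0 < r i)%N) ->
  zetaA_cvg R N (dA a b c p q r) ->
  Z R (spp_word a b c p q r) = zetaA R N (dA a b c p q r).
Proof.
have [n] := ubnP (a + b)%N; elim: n => // n IHn in a b c p q r *.
rewrite ltnS => le_n defN p0 q0 r0 s_cvg.
have [a0|a0] := posnP a; first by apply: Z_spp_word_degenerate => //; left.
have [b0|b0] := posnP b; first by apply: Z_spp_word_degenerate => //; right.
have pa : (0 < p a)%N by apply: p0; rewrite a0 leqnn.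
have qb : (0 < q b)%N by apply: q0; rewrite b0 leqnn.
have [cvg1 cvg2 ->] := pfd_zetaA_dA defN a0 b0 pa qb s_cvg.
rewrite spp_expansion // ZD !Z_sum.
congr (_ + _); apply: eq_bigr => tau _; have lt_tau := ltn_ord tau.
  rewrite ZnatZ spp_leftE // IHn //; try lia.
  - by move=> i ia; apply: p0; lia.
  - by apply: set_at_pos; [lia | exact: q0].
  - by apply: ins_first_pos; [lia | exact: r0].
  - exact: cvg1.
rewrite ZnatZ spp_rightE // IHn //; try lia.
- by apply: set_at_pos; [lia | exact: p0].
- by move=> i ib; apply: q0; lia.
- by apply: ins_first_pos; [lia | exact: r0].
- exact: cvg2.
Qed.


Theorem theorem2p3 (R : realType) (a b c : nat) (p q r : nat -> nat)
    (ha : (0 < a)%N) (hb : (0 < b)%N)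
    (hp : forall eta : nat, (1 <= eta <= a)%N -> (0 < p eta)%N)
    (hq : forall xi : nat, (1 <= xi <= b)%N -> (0 < q xi)%N)
    (hr : forall sigma : nat, (1 <= sigma <= c)%N -> (0 < r sigma)%N) :
  let N := (a + b + c)%N in
  (zetaA_cvg R N (dA a b c p q r) ->
     H0 (spp_word a b c p q r) /\
     Z R (spp_word a b c p q r) = zetaA R N (dA a b c p q r))
  /\
  spp_word a b c p q r
    = \sum_(tau < q b) 'C(p a - 1 + tau, tau)%:R *: spp_left a b c p q r tau
    + \sum_(tau < p a) 'C(q b - 1 + tau, tau)%:R *: spp_right a b c p q r tau
  /\
  (zetaA_cvg R N (dA a b c p q r) ->
     [/\ pfd_step R N (1%N, (b + c + 1)%N) ((a + 1)%N, (a + c + 1)%N)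
           (dA a b c p q r) (dA_left a b c p q r) (dA_right a b c p q r),
         (forall tau : nat, (tau < q b)%N ->
            [/\ H0 (spp_left a b c p q r tau),
                zetaA_cvg R N (dA_left a b c p q r tau) &
                Z R (spp_left a b c p q r tau)
                  = zetaA R N (dA_left a b c p q r tau)]),
         (forall tau : nat, (tau < p a)%N ->
            [/\ H0 (spp_right a b c p q r tau),
                zetaA_cvg R N (dA_right a b c p q r tau) &
                Z R (spp_right a b c p q r tau)
                  = zetaA R N (dA_right a b c p q r tau)]) &
         zetaA R N (dA a b c p q r)
           = \sum_(tau < q b) 'C(p a - 1 + tau, tau)%:R
                * zetaA R N (dA_left a b c p q r tau)
           + \sum_(tau < p a) 'C(q b - 1 + tau, tau)%:R
                * zetaA R N (dA_right a b c p q r tau)]).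
Proof.
move=> N; have defN : N = (a + b + c)%N by [].
have pa : (0 < p a)%N by apply: hp; rewrite ha leqnn.
have qb : (0 < q b)%N by apply: hq; rewrite hb leqnn.
split; last split.
- by move=> s_cvg; split; [exact: H0_of_cvg defN _ _ _ s_cvg | exact: Z_spp_word].
- exact: spp_expansion.
move=> s_cvg; have [cvg1 cvg2 zetaE] := pfd_zetaA_dA defN ha hb pa qb s_cvg.
split; [exact: pfd_step_dA | move=> tau lt_tau | move=> tau lt_tau | exact: zetaE].
  have defN' : N = (a.-1 + b + c.+1)%N by rewrite defN; lia.
  have p0 i : (1 <= i <= a.-1)%N -> (0 < p i)%N by move=> ia; apply: hp; lia.
  have q0 : forall i, (1 <= i <= b)%N -> (0 < set_at b (q b - tau) q i)%N.
    by apply: set_at_pos; [lia | exact: hq].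
  have r0 : forall i, (1 <= i <= c.+1)%N -> (0 < ins_first (p a + tau) r i)%N.
    by apply: ins_first_pos; [lia | exact: hr].
  have s'_cvg := cvg1 tau lt_tau; rewrite spp_leftE //; split=> //.
    exact: H0_of_cvg defN' p0 q0 r0 s'_cvg.
  exact: Z_spp_word defN' p0 q0 r0 s'_cvg.
have defN' : N = (a + b.-1 + c.+1)%N by rewrite defN; lia.
have p0 : forall i, (1 <= i <= a)%N -> (0 < set_at a (p a - tau) p i)%N.
  by apply: set_at_pos; [lia | exact: hp].
have q0 i : (1 <= i <= b.-1)%N -> (0 < q i)%N by move=> ib; apply: hq; lia.
have r0 : forall i, (1 <= i <= c.+1)%N -> (0 < ins_first (q b + tau) r i)%N.
  by apply: ins_first_pos; [lia | exact: hr].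
have s'_cvg := cvg2 tau lt_tau; rewrite spp_rightE //; split=> //.
  exact: H0_of_cvg defN' p0 q0 r0 s'_cvg.
exact: Z_spp_word defN' p0 q0 r0 s'_cvg.
Qed.
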